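(* Let $\lambda>0$ and $-1<\alpha,\beta<1$. Then, for any $\theta>0$, the operator $\mathbf{H}_{\lambda}$ is bounded from $\mathcal{F}^{2}_{\theta,\alpha}$ to $\mathcal{F}^{2}_{\theta,\beta}$ if and only if $\lambda\geq 1+\frac{1}{2}(\beta-\alpha)$.
   Context: $\mathcal{H}(\mathbb{C})$ denotes the class of all entire functions on $\mathbb{C}$. For $\theta>0$ and $\alpha\in\mathbb{R}$, the weighted Fock space is $$\mathcal{F}^{2}_{\theta,\alpha}=\Big\{f=\sum_{n=0}^{\infty}a_nz^n\in\mathcal{H}(\mathbb{C}):\ \|f\|_{\theta,\alpha}^2:=\sum_{n=0}^{\infty}(n+\theta)^{\alpha}|a_n|^2\,n!<\infty\Big\}.$$ It is a Hilbert space with inner product $\langle f,g\rangle=\sum_{n=0}^{\infty}(n+\theta)^{\alpha}a_n\overline{b_n}\,n!$ for $f=\sum a_nz^n$, $g=\sum b_nz^n$. Any power series whose coefficients satisfy the summability condition is automatically entire. For $\lambda>0$ and $f=\sum_{k=0}^{\infty}a_kz^k\in\mathcal{H}(\mathbb{C})$, the Hilbert-type operator $\mathbf{H}_{\lambda}$ is defined by $$\mathbf{H}_{\lambda}(f)(z):=\sum_{n=0}^{\infty}\left[\frac{1}{\sqrt{n!}}\sum_{k=0}^{\infty}\frac{a_k\sqrt{k!}}{(k+n)^{\lambda}+1}\right]z^n.$$ Bounded from $\mathcal{F}^{2}_{\theta,\alpha}$ to $\mathcal{F}^{2}_{\theta,\beta}$ means that for every $f\in\mathcal{F}^{2}_{\theta,\alpha}$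 the coefficient series converge, $\mathbf{H}_\lambda(f)\in\mathcal{F}^{2}_{\theta,\beta}$, and there is a constant $C>0$ independent of $f$ with $\|\mathbf{H}_\lambda(f)\|_{\theta,\beta}\le C\|f\|_{\theta,\alpha}$. *)

(* Defs.v *)
From Stdlib Require Import Reals Factorial Lra ClassicalEpsilon FunctionalExtensionality.
From Coquelicot Require Export Coquelicot.
Open Scope R_scope.

Definition ex_Cseries (a : nat -> C) : Prop :=
  @ex_series C_AbsRing C_NormedModule a.

(** Total sum operator, meaningful only under [ex_Cseries a]. *)
Definition Cseries (a : nat -> C) : C :=
  @iota C_CompleteNormedModule
    (fun s => @is_series C_AbsRing C_NormedModule a s).

Lemma Cseries_unique (a : nat -> C) (s : C) :
  @is_series C_AbsRing C_NormedModule a s -> Cseries a = s.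
Proof.
intros H.
apply (@iota_unique C_AbsRing C_CompleteNormedModule); auto.
intros t Ht.
exact (@filterlim_locally_unique nat C_AbsRing C_NormedModule eventually _
         _ t s Ht H).
Qed.

Definition entire (f : C -> C) : Prop :=
  forall z : C, @ex_derive C_AbsRing C_NormedModule f z.

Definition has_expansion (f : C -> C) (a : nat -> C) : Prop :=
  forall z : C, @is_pseries C_AbsRing C_NormedModule a z (f z).

(** The sequence [a] with [has_expansion f a]; it is unique when it exists
    ([taylor_unique]), and junk otherwise. *)
Definition taylor (f : C -> C) : nat -> C :=
  epsilon (inhabits (fun _ : nat => RtoC 0)) (has_expansion f).

Lemma is_series_Re (a : nat -> C) (s : C) :
  @is_series C_AbsRing C_NormedModule a s ->
  is_series (fun n => Re (a n)) (Re s).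
Proof.
unfold is_series; intros H.
apply filterlim_ext with (fun n => fst (@sum_n C_AbelianGroup a n)).
- intros n; induction n as [|n IH].
  + now rewrite !sum_O.
  + rewrite !sum_Sn, <- IH; reflexivity.
- eapply filterlim_comp; [exact H|].
  intros P [eps HP]; exists eps; intros y Hy; apply HP; apply Hy.
Qed.

Lemma is_series_Im (a : nat -> C) (s : C) :
  @is_series C_AbsRing C_NormedModule a s ->
  is_series (fun n => Im (a n)) (Im s).
Proof.
unfold is_series; intros H.
apply filterlim_ext with (fun n => snd (@sum_n C_AbelianGroup a n)).
- intros n; induction n as [|n IH].
  + now rewrite !sum_O.
  + rewrite !sum_Sn, <- IH; reflexivity.
- eapply filterlim_comp; [exact H|].
  intros P [eps HP]; exists eps; intros y Hy; apply HP; apply Hy.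
Qed.

Lemma pow_n_RtoC (x : R) (n : nat) :
  @pow_n C_Ring (RtoC x) n = RtoC (@pow_n R_Ring x n).
Proof.
induction n as [|n IH]; [reflexivity|].
simpl; rewrite IH; symmetry; apply RtoC_mult.
Qed.

Lemma has_expansion_Re (f : C -> C) (a : nat -> C) (x : R) :
  has_expansion f a -> is_pseries (fun n => Re (a n)) x (Re (f (RtoC x))).
Proof.
intros H; specialize (H (RtoC x)); apply is_series_Re in H.
eapply is_series_ext; [|exact H].
intros n; cbv beta; rewrite pow_n_RtoC.
set (p := pow_n x n); set (c := a n).
change (Re (RtoC p * c)%C = p * Re c).
unfold Re, RtoC, Cmult; simpl; ring.
Qed.

Lemma has_expansion_Im (f : C -> C) (a : nat -> C) (x : R) :
  has_expansion f a -> is_pseries (fun n => Im (a n)) x (Im (f (RtoC x))).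
Proof.
intros H; specialize (H (RtoC x)); apply is_series_Im in H.
eapply is_series_ext; [|exact H].
intros n; cbv beta; rewrite pow_n_RtoC.
set (p := pow_n x n); set (c := a n).
change (Im (RtoC p * c)%C = p * Im c).
unfold Im, RtoC, Cmult; simpl; ring.
Qed.

Lemma real_pseries_unique (u v : nat -> R) (g : R -> R) :
  (forall x, is_pseries u x (g x)) -> (forall x, is_pseries v x (g x)) ->
  forall n, u n = v n.
Proof.
assert (cv : forall w : nat -> R, (forall x, is_pseries w x (g x)) ->
               Rbar_lt 0 (CV_radius w)).
{ intros w Hw; apply Rbar_lt_le_trans with 1; [simpl; lra|].
  apply Rbar_not_lt_le; intros Hlt.
  apply (CV_disk_outside w 1).
  - rewrite Rabs_R1; exact Hlt.
  - apply ex_series_lim_0.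
    exists (g 1); eapply is_series_ext; [|exact (Hw 1)].
    intros n; rewrite pow_n_pow; apply Rmult_comm. }
intros Hu Hv n.
apply PSeries_ext_recip; auto.
exists (mkposreal 1 Rlt_0_1); intros x _.
now rewrite (is_pseries_unique _ _ _ (Hu x)), (is_pseries_unique _ _ _ (Hv x)).
Qed.

Lemma taylor_unique (f : C -> C) (a : nat -> C) :
  has_expansion f a -> taylor f = a.
Proof.
intros Ha.
assert (Ht : has_expansion f (taylor f)).
{ unfold taylor; apply epsilon_spec; now exists a. }
apply functional_extensionality; intros n.
apply injective_projections.
- apply (real_pseries_unique (fun n => Re (taylor f n)) (fun n => Re (a n))
           (fun x => Re (f (RtoC x)))); intros x; now apply has_expansion_Re.
- apply (real_pseries_unique (fun n => Im (taylor f n)) (fun n => Im (a n))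
           (fun x => Im (f (RtoC x)))); intros x; now apply has_expansion_Im.
Qed.

Definition fock_term (theta alpha : R) (f : C -> C) (n : nat) : R :=
  Rpower (INR n + theta) alpha * (Cmod (taylor f n))^2 * INR (fact n).

Definition in_fock (theta alpha : R) (f : C -> C) : Prop :=
  entire f /\ has_expansion f (taylor f) /\ ex_series (fock_term theta alpha f).

Definition fock_norm (theta alpha : R) (f : C -> C) : R :=
  sqrt (Series (fock_term theta alpha f)).

(** [m ^ lambda] for [lambda > 0]; [Rpower 0 lambda] would be 1, not 0. *)
Definition nat_rpow (m : nat) (lambda : R) : R :=
  match m with
  | O => 0
  | S _ => Rpower (INR m) lambda
  end.

Definition hilbert_term (lambda : R) (f : C -> C) (n k : nat) : C :=
  (taylor f k * RtoC (sqrt (INR (fact k))) /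
     RtoC (nat_rpow (k + n) lambda + 1))%C.

Definition hilbert_coef (lambda : R) (f : C -> C) (n : nat) : C :=
  (RtoC (/ sqrt (INR (fact n))) * Cseries (hilbert_term lambda f n))%C.

Definition hilbert_op (lambda : R) (f : C -> C) (z : C) : C :=
  Cseries (fun n => (hilbert_coef lambda f n * Cpow z n)%C).

(** All the series in the definition of [hilbert_op lambda f] converge. *)
Definition hilbert_op_defined (lambda : R) (f : C -> C) : Prop :=
  (forall n : nat, ex_Cseries (hilbert_term lambda f n)) /\
  (forall z : C, ex_Cseries (fun n => (hilbert_coef lambda f n * Cpow z n)%C)).

Definition hilbert_op_bounded (lambda theta alpha beta : R) : Prop :=
  exists K : R, 0 < K /\
    forall f : C -> C, in_fock theta alpha f ->
      hilbert_op_defined lambda f /\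
      in_fock theta beta (hilbert_op lambda f) /\
      fock_norm theta beta (hilbert_op lambda f) <= K * fock_norm theta alpha f.

(* Main.v *)
Require Import Defs.
From Stdlib Require Import Reals Factorial Lra Lia Psatz.
Open Scope R_scope.

(** Put [x k = |a_k| sqrt (k!)]. The norm of [f] in the source space is a weighted l^2 norm
    of [x], with weight [(k+theta)^alpha], and the moduli of the coefficients of the image,
    scaled by [sqrt (n!)], are at most the sums over [k] of [x k / ((k+n)^lambda + 1)].
    The statement is therefore about the matrix [1 / ((k+n)^lambda + 1)] between two
    weighted l^2 spaces.

    If [lambda >= l0 := 1 + (beta - alpha)/2], the matrix is dominated by a multiple of
    [(n+k+1)^(-l0)], and the Schur test with the weights [(k+1)^(-(1+alpha)/2)] applies
    ([schur_test], [hilbert_kernel_sections]). Both conditions of the test are instances of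
    one estimate, [power_sum_bound]: the sum of [(k+1)^(-s) (n+k+1)^(-l)] over [k] is at
    most a multiple of [(n+1)^(1-s-l)] when [0 < s < 1 < s + l]. The hypotheses
    [-1 < alpha, beta < 1] say exactly that the two exponents [s = (1+alpha)/2] and
    [s = (1-beta)/2] lie in [(0,1)]. All these estimates are on finite sections, with
    constants independent of the section, so that no double series has to be exchanged;
    the infinite sums come from [weighted_square_sum_limit]. A sequence of coefficients
    with finite Fock norm defines an entire function because the factorial beats every
    power ([fock_coef_summable], [entire_of_abs_summable], [power_series_in_fock]).

    Conversely, let [f] be the polynomial with [a_k sqrt (k!) = 1] for [N <= k < 2N] and
    [a_k = 0] otherwise. Its squared norm is at most a multiple of [N^(1+alpha)], while for
    [N <= n < 2N] the sum over [k] is at least a multiple of [N^(1-lambda)], so that the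
    squared norm of the image is at least a multiple of [N^(1+beta+2-2 lambda)]. Letting [N]
    tend to infinity forces [2 + beta - alpha - 2 lambda <= 0]. *)

(** * Real powers and finite sums *)

Lemma Rpower_pos (x e : R) : 0 < Rpower x e.
Proof. apply exp_pos. Qed.

Lemma Rpower_antitone (x y e : R) :
  0 < x <= y -> e <= 0 -> Rpower y e <= Rpower x e.
Proof.
intros Hxy He.
rewrite <- (Ropp_involutive e), (Rpower_Ropp y), (Rpower_Ropp x).
apply Rinv_le_contravar; [apply Rpower_pos|].
apply Rle_Rpower_l; lra.
Qed.

(** Mean value theorem for [t^p / p], whose derivative [t^(p-1)] decreases. The division by
    [p] makes one statement cover the growing powers ([p > 0]) and the decaying ones
    ([p < 0]). *)
Lemma Rpower_increment (x p : R) :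
  0 < x -> p < 1 -> p <> 0 ->
  Rpower (x + 1) (p - 1) <= (Rpower (x + 1) p - Rpower x p) / p.
Proof.
intros Hx Hp Hp0.
destruct (MVT_cor2 (fun t => Rpower t p) (fun t => p * Rpower t (p - 1)) x (x + 1))
  as [c [Hc1 Hc2]]; [lra| |].
- intros c Hc; apply derivable_pt_lim_power; lra.
- rewrite Hc1.
  replace (p * Rpower c (p - 1) * (x + 1 - x) / p) with (Rpower c (p - 1))
    by (field; assumption).
  apply Rpower_antitone; lra.
Qed.

Lemma Rpower_1_base (e : R) : Rpower 1 e = 1.
Proof. unfold Rpower; rewrite ln_1, Rmult_0_r; apply exp_0. Qed.

Lemma INR_S_pos (n : nat) : 0 < INR n + 1.
Proof. pose proof (pos_INR n); lra. Qed.

Lemma sum_f_R0_term_le (a : nat -> R) (N : nat) :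
  (forall k, 0 <= a k) -> a N <= sum_f_R0 a N.
Proof.
intros H; destruct N as [|N]; [apply Rle_refl|].
simpl; pose proof (cond_pos_sum a N H); lra.
Qed.

Lemma sum_f_R0_incr_bound (a : nat -> R) (N M : nat) :
  (forall k, 0 <= a k) -> (N <= M)%nat -> sum_f_R0 a N <= sum_f_R0 a M.
Proof.
intros H; induction 1 as [|M _ IH]; [lra|].
simpl; specialize (H (S M)); lra.
Qed.

Lemma sum_f_R0_swap (a : nat -> nat -> R) (N M : nat) :
  sum_f_R0 (fun n => sum_f_R0 (a n) M) N =
  sum_f_R0 (fun k => sum_f_R0 (fun n => a n k) N) M.
Proof.
induction N as [|N IH]; simpl; [reflexivity|].
rewrite IH, <- sum_plus; reflexivity.
Qed.

(** The part [k <= n] of the sum in [power_sum_bound]: the second factor is at most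
    [(n+1)^(-l)], and the sum of the first telescopes. *)
Lemma power_sum_head (s l : R) (n M : nat) :
  0 < s < 1 -> 0 <= l -> (M <= n)%nat ->
  sum_f_R0 (fun k => Rpower (INR k + 1) (- s) * Rpower (INR n + INR k + 1) (- l)) M
  <= Rpower (INR n + 1) (- l) * (Rpower (INR M + 1) (1 - s) / (1 - s)).
Proof.
intros Hs Hl HM.
assert (Hdec : forall k, Rpower (INR n + INR k + 1) (- l) <= Rpower (INR n + 1) (- l)).
{ intros k; pose proof (pos_INR k); pose proof (pos_INR n).
  apply Rpower_antitone; lra. }
pose proof (Rpower_pos (INR n + 1) (- l)) as Hn.
induction M as [|M IH].
- simpl sum_f_R0; simpl (INR 0); rewrite !Rplus_0_r, !Rplus_0_l, !Rpower_1_base.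
  rewrite Rmult_1_l.
  assert (1 <= 1 / (1 - s)) by (apply Rle_div_r; lra).
  nra.
- cbn [sum_f_R0]; specialize (IH ltac:(lia)).
  rewrite S_INR in *.
  pose proof (Rpower_increment (INR M + 1) (1 - s) (INR_S_pos M) ltac:(lra) ltac:(lra)) as Hinc.
  replace (1 - s - 1) with (- s) in Hinc by ring.
  specialize (Hdec (S M)); rewrite S_INR in Hdec.
  pose proof (Rpower_pos (INR M + 1 + 1) (- s)) as Hp.
  apply Rle_trans with
   (Rpower (INR n + 1) (- l) * (Rpower (INR M + 1) (1 - s) / (1 - s)) +
    Rpower (INR M + 1 + 1) (- s) * Rpower (INR n + 1) (- l)).
  + apply Rplus_le_compat; [exact IH|].
    apply Rmult_le_compat_l; lra.
  + replace (Rpower (INR M + 1 + 1) (1 - s) / (1 - s)) with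
      (Rpower (INR M + 1) (1 - s) / (1 - s) +
       (Rpower (INR M + 1 + 1) (1 - s) - Rpower (INR M + 1) (1 - s)) / (1 - s))
      by (field; lra).
    nra.
Qed.

(** The part [k <= n] is [power_sum_head]; for [k > n] the summand is at most
    [(k+1)^(-s-l)], whose sum telescopes since [s + l > 1]. *)
Lemma power_sum_bound (s l : R) (n M : nat) :
  0 < s < 1 -> 0 <= l -> 1 < s + l ->
  sum_f_R0 (fun k => Rpower (INR k + 1) (- s) * Rpower (INR n + INR k + 1) (- l)) M
  <= (/ (1 - s) + / (s + l - 1)) * Rpower (INR n + 1) (1 - s - l).
Proof.
intros Hs Hl Hsl.
set (a := fun k => _).
assert (Ha : forall k, 0 <= a k).
{ intros k; apply Rmult_le_pos; apply Rlt_le, Rpower_pos. }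
(* The subtracted power is what makes the induction on [j] telescope. *)
assert (Htail : forall j, sum_f_R0 a (n + j) <=
  Rpower (INR n + 1) (1 - s - l) / (1 - s) +
  (Rpower (INR n + 1) (1 - s - l) - Rpower (INR n + INR j + 1) (1 - s - l)) / (s + l - 1)).
{ induction j as [|j IH].
  - rewrite Nat.add_0_r; simpl (INR 0); rewrite Rplus_0_r.
    eapply Rle_trans; [apply (power_sum_head s l n n); auto; lra|].
    replace (Rpower (INR n + 1) (1 - s - l)) with
      (Rpower (INR n + 1) (- l) * Rpower (INR n + 1) (1 - s))
      by (rewrite <- Rpower_plus; f_equal; ring).
    apply Req_le; field; lra.
  - rewrite Nat.add_succ_r; cbn [sum_f_R0].
    assert (Hle : a (S (n + j)) <= Rpower (INR n + INR j + 1 + 1) (- s - l)).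
    { unfold a; rewrite S_INR, plus_INR.
      pose proof (pos_INR n); pose proof (pos_INR j).
      unfold Rminus; rewrite Rpower_plus; apply Rmult_le_compat_l.
      - apply Rlt_le, Rpower_pos.
      - apply Rpower_antitone; lra. }
    pose proof (pos_INR n) as Hn; pose proof (pos_INR j) as Hj.
    pose proof (Rpower_increment (INR n + INR j + 1) (1 - s - l)
       ltac:(lra) ltac:(lra) ltac:(lra)) as Hinc.
    replace (1 - s - l - 1) with (- s - l) in Hinc by ring.
    rewrite S_INR.
    replace (INR n + (INR j + 1) + 1) with (INR n + INR j + 1 + 1) by ring.
    set (u := Rpower (INR n + INR j + 1 + 1) (1 - s - l)) in *.
    set (v := Rpower (INR n + INR j + 1) (1 - s - l)) in *.
    set (w := Rpower (INR n + 1) (1 - s - l)) in *.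
    replace ((w - u) / (s + l - 1)) with ((w - v) / (s + l - 1) + (u - v) / (1 - s - l))
      by (field; lra).
    lra. }
apply Rle_trans with (sum_f_R0 a (n + M)).
- apply sum_f_R0_incr_bound; [exact Ha|lia].
- eapply Rle_trans; [apply Htail|].
  assert (0 < Rpower (INR n + INR M + 1) (1 - s - l) / (s + l - 1)).
  { apply Rdiv_lt_0_compat; [apply Rpower_pos|lra]. }
  unfold Rdiv in *; lra.
Qed.

(** * The Schur test *)

Lemma weighted_cauchy_schwarz (d u x : nat -> R) (M : nat) :
  (forall k, 0 <= d k) -> (forall k, 0 < u k) -> (forall k, 0 <= x k) ->
  (sum_f_R0 (fun k => d k * x k) M)^2 <=
  sum_f_R0 (fun k => d k * u k) M * sum_f_R0 (fun k => d k * (x k ^ 2 / u k)) M.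
Proof.
intros Hd Hu Hx.
assert (Hstep : forall k, 0 <= d k * (x k ^ 2 / u k)).
{ intros k; apply Rmult_le_pos; [apply Hd|].
  apply Rle_div_r; [apply Hu|rewrite Rmult_0_l; apply pow2_ge_0]. }
induction M as [|M IH]; cbn [sum_f_R0].
- specialize (Hu O); apply Req_le; field; lra.
- revert IH.
  set (S0 := sum_f_R0 (fun k => d k * x k) M).
  set (P := sum_f_R0 (fun k => d k * u k) M).
  set (Q := sum_f_R0 (fun k => d k * (x k ^ 2 / u k)) M).
  intros IH.
  assert (HS : 0 <= S0) by (apply cond_pos_sum; intros; apply Rmult_le_pos; auto).
  assert (HP : 0 <= P)
    by (apply cond_pos_sum; intros; apply Rmult_le_pos; auto; apply Rlt_le; auto).
  assert (HQ : 0 <= Q) by (apply cond_pos_sum; auto).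
  specialize (Hd (S M)); specialize (Hu (S M)); specialize (Hx (S M)).
  set (e := d (S M)) in *; set (y := x (S M)) in *; set (v := u (S M)) in *.
  replace ((P + e * v) * (Q + e * (y ^ 2 / v))) with
    (P * Q + e ^ 2 * y ^ 2 + e * (P * (y ^ 2 / v) + Q * v)) by (field; lra).
  (* The cross term [2 S0 y] is bounded by the two mixed terms of the product, by the
     arithmetic-geometric mean inequality and the induction hypothesis. *)
  assert (Hcross : 2 * (S0 * y) <= P * (y ^ 2 / v) + Q * v).
  { assert (Ha : 0 <= P * (y ^ 2 / v)).
    { apply Rmult_le_pos; auto; apply Rle_div_r; [lra|nra]. }
    assert (Hb : 0 <= Q * v) by nra.
    assert (Hab : (P * (y ^ 2 / v)) * (Q * v) = P * Q * y ^ 2) by (field; lra).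
    assert (Hy : 0 <= y ^ 2) by apply pow2_ge_0.
    assert (Hc : (S0 * y) ^ 2 <= (P * (y ^ 2 / v)) * (Q * v)).
    { rewrite Hab, Rpow_mult_distr; apply Rmult_le_compat_r; assumption. }
    set (a := P * (y ^ 2 / v)) in *; set (b := Q * v) in *.
    apply Rsqr_incr_0_var; [|lra]; unfold Rsqr.
    pose proof (Rle_0_sqr (a - b)); unfold Rsqr in *; nra. }
  apply (Rmult_le_compat_l e) in Hcross; [|exact Hd].
  replace ((S0 + e * y) ^ 2) with (S0 ^ 2 + e ^ 2 * y ^ 2 + e * (2 * (S0 * y))) by ring.
  lra.
Qed.

(** Schur test for a nonnegative matrix [D], on a finite section: [u] is the test sequence,
    [C1 p] bounds its image under [D], and the weighted image of [p] under the transpose is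
    bounded by [C2 u v]. Then the squared norm of [D x] with weight [w] is at most [C1 C2]
    times the squared norm of [x] with weight [v]. *)
Lemma schur_test (D : nat -> nat -> R) (u v w p x : nat -> R) (C1 C2 : R) (N M : nat) :
  (forall n k, 0 <= D n k) -> (forall k, 0 < u k) -> (forall n, 0 <= w n) ->
  0 <= C1 ->
  (forall n, sum_f_R0 (fun k => D n k * u k) M <= C1 * p n) ->
  (forall k, sum_f_R0 (fun n => w n * p n * D n k) N <= C2 * (u k * v k)) ->
  (forall k, 0 <= x k) ->
  sum_f_R0 (fun n => w n * (sum_f_R0 (fun k => D n k * x k) M)^2) N <=
  C1 * C2 * sum_f_R0 (fun k => v k * x k ^ 2) M.
Proof.
intros HD Hu Hw HC1 Hrow Hcol Hx.
assert (Hq : forall k, 0 <= x k ^ 2 / u k).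
{ intros k; apply Rle_div_r; [apply Hu|rewrite Rmult_0_l; apply pow2_ge_0]. }
apply Rle_trans with
  (sum_f_R0 (fun n => sum_f_R0 (fun k => C1 * (w n * p n * D n k * (x k ^ 2 / u k))) M) N).
- apply sum_Rle; intros n _.
  eapply Rle_trans.
  + apply Rmult_le_compat_l; [apply Hw|].
    apply (weighted_cauchy_schwarz (D n) u x M); auto.
  + apply Rle_trans with
      (w n * (C1 * p n * sum_f_R0 (fun k => D n k * (x k ^ 2 / u k)) M)).
    * apply Rmult_le_compat_l; [apply Hw|].
      apply Rmult_le_compat_r; [|apply Hrow].
      apply cond_pos_sum; intros; apply Rmult_le_pos; auto.
    * apply Req_le; rewrite <- Rmult_assoc, scal_sum.
      apply sum_eq; intros; ring.
- rewrite sum_f_R0_swap, scal_sum; apply sum_Rle; intros k _.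
  apply Rle_trans with (C1 * (x k ^ 2 / u k) * sum_f_R0 (fun n => w n * p n * D n k) N).
  + apply Req_le; rewrite scal_sum; apply sum_eq; intros; ring.
  + apply Rle_trans with (C1 * (x k ^ 2 / u k) * (C2 * (u k * v k))).
    * apply Rmult_le_compat_l; [apply Rmult_le_pos; auto|apply Hcol].
    * apply Req_le; field; apply Rgt_not_eq, Hu.
Qed.

(** The weights [(n+theta)^e] and [(n+1)^e] are equivalent, since [|ln ((n+theta)/(n+1))|]
    is at most [|ln theta|]. *)
Lemma shift_power_equiv (theta e : R) : 0 < theta ->
  exists c, 0 < c /\ forall n,
    Rpower (INR n + theta) e <= c * Rpower (INR n + 1) e /\
    Rpower (INR n + 1) e <= c * Rpower (INR n + theta) e.
Proof.
intros Ht; exists (exp (Rabs e * Rabs (ln theta))); split; [apply exp_pos|].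
intros n; pose proof (pos_INR n) as Hn.
assert (H : Rabs (ln (INR n + theta) - ln (INR n + 1)) <= Rabs (ln theta)).
{ assert (Hle : forall x y, 0 < x -> x <= y -> ln x <= ln y).
  { intros x y Hx [Hxy| ->]; [apply Rlt_le, ln_increasing; assumption|lra]. }
  pose proof ln_1 as L1.
  destruct (Rle_dec theta 1) as [H1|H1].
  - pose proof (Hle theta 1 ltac:(lra) ltac:(lra)).
    pose proof (Hle (INR n + theta) (INR n + 1) ltac:(lra) ltac:(lra)).
    pose proof (Hle (theta * (INR n + 1)) (INR n + theta) ltac:(nra) ltac:(nra)) as H3.
    rewrite ln_mult in H3 by lra.
    rewrite !Rabs_left1 by lra; lra.
  - pose proof (Hle 1 theta ltac:(lra) ltac:(lra)).
    pose proof (Hle (INR n + 1) (INR n + theta) ltac:(lra) ltac:(lra)).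
    pose proof (Hle (INR n + theta) (theta * (INR n + 1)) ltac:(nra) ltac:(nra)) as H3.
    rewrite ln_mult in H3 by lra.
    rewrite !Rabs_pos_eq by lra; lra. }
assert (He : Rabs (e * (ln (INR n + theta) - ln (INR n + 1))) <= Rabs e * Rabs (ln theta)).
{ rewrite Rabs_mult; apply Rmult_le_compat_l; [apply Rabs_pos|exact H]. }
apply Rabs_le_between in He.
unfold Rpower; rewrite <- !exp_plus.
assert (Hexp : forall a b, a <= b -> exp a <= exp b).
{ intros a b [Hab| ->]; [apply Rlt_le, exp_increasing; exact Hab|lra]. }
split; apply Hexp; lra.
Qed.

(** * Boundedness of the finite sections of the matrix *)

(** The matrix of the operator between the normalized coefficient sequences. *)
Definition hilbert_kernel (lambda : R) (n k : nat) : R :=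
  / (nat_rpow (k + n) lambda + 1).

Lemma nat_rpow_ge_0 (m : nat) (l : R) : 0 <= nat_rpow m l.
Proof. destruct m; simpl; [lra|apply Rlt_le, Rpower_pos]. Qed.

Lemma hilbert_kernel_pos (l : R) (n k : nat) : 0 < hilbert_kernel l n k.
Proof.
apply Rinv_0_lt_compat; pose proof (nat_rpow_ge_0 (k + n) l); lra.
Qed.

(** For [m = n + k >= 1], [m >= (m+1)/2] and [m^l >= m^l0]; for [m = 0] the left-hand side
    is [1]. *)
Lemma hilbert_kernel_le (l l0 : R) (n k : nat) :
  0 <= l0 <= l ->
  hilbert_kernel l n k <= Rpower 2 l0 * Rpower (INR n + INR k + 1) (- l0).
Proof.
intros Hl; unfold hilbert_kernel.
rewrite Rpower_Ropp, <- (Rinv_inv (Rpower 2 l0)), <- Rinv_mult.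
apply Rinv_le_contravar.
{ apply Rmult_lt_0_compat; [apply Rinv_0_lt_compat|]; apply Rpower_pos. }
rewrite (Rplus_comm (INR n)), <- plus_INR.
rewrite <- (Rpower_Ropp 2), ?Rinv_inv.
destruct (k + n)%nat as [|m].
- simpl nat_rpow; simpl (INR 0); rewrite Rplus_0_l, Rpower_1_base, Rmult_1_r.
  rewrite <- (Rpower_O 2) by lra; apply Rle_Rpower; lra.
- unfold nat_rpow.
  assert (H1 : 1 <= INR (S m)) by (rewrite S_INR; pose proof (pos_INR m); lra).
  assert (H2 : Rpower (INR (S m)) l0 <= Rpower (INR (S m)) l).
  { apply Rle_Rpower; lra. }
  assert (H3 : Rpower (INR (S m) + 1) l0 <= Rpower (2 * INR (S m)) l0).
  { apply Rle_Rpower_l; lra. }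
  rewrite <- Rpower_mult_distr in H3 by lra.
  assert (H4 : Rpower 2 (- l0) * Rpower 2 l0 = 1).
  { rewrite <- Rpower_plus, Rplus_opp_l; apply Rpower_O; lra. }
  pose proof (Rpower_pos 2 (- l0)).
  apply Rle_trans with (Rpower 2 (- l0) * (Rpower 2 l0 * Rpower (INR (S m)) l0)).
  + apply Rmult_le_compat_l; lra.
  + rewrite <- Rmult_assoc, H4; lra.
Qed.

(** The constant does not depend on the section [N, M]. *)
Lemma hilbert_kernel_sections (lambda alpha beta theta : R) :
  -1 < alpha < 1 -> -1 < beta < 1 -> 0 < theta ->
  1 + 1 / 2 * (beta - alpha) <= lambda ->
  exists K, 0 < K /\ forall (x : nat -> R) (N M : nat), (forall k, 0 <= x k) ->
    sum_f_R0 (fun n => Rpower (INR n + theta) beta *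
                 (sum_f_R0 (fun k => hilbert_kernel lambda n k * x k) M)^2) N <=
    K * sum_f_R0 (fun k => Rpower (INR k + theta) alpha * x k ^ 2) M.
Proof.
intros Ha Hb Ht Hl.
set (l0 := 1 + 1 / 2 * (beta - alpha)) in *.
destruct (shift_power_equiv theta beta Ht) as [cb [Hcb Hbeta]].
destruct (shift_power_equiv theta alpha Ht) as [ca [Hca Halpha]].
set (K1 := / (1 - (1 + alpha) / 2) + / ((1 + alpha) / 2 + l0 - 1)).
set (K2 := / (1 - (1 - beta) / 2) + / ((1 - beta) / 2 + l0 - 1)).
assert (HK1 : 0 < K1) by (apply Rplus_lt_0_compat; apply Rinv_0_lt_compat; unfold l0; lra).
assert (HK2 : 0 < K2) by (apply Rplus_lt_0_compat; apply Rinv_0_lt_compat; unfold l0; lra).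
pose proof (Rpower_pos 2 l0) as H2.
exists (cb * (Rpower 2 l0 * K1) * (Rpower 2 l0 * K2) * ca); split.
{ repeat apply Rmult_lt_0_compat; assumption. }
intros x N M Hx.
apply Rle_trans with (cb * sum_f_R0 (fun n => Rpower (INR n + 1) beta *
                 (sum_f_R0 (fun k => hilbert_kernel lambda n k * x k) M)^2) N).
{ rewrite scal_sum; apply sum_Rle; intros n _.
  set (q := (sum_f_R0 _ M)^2).
  assert (0 <= q) by apply pow2_ge_0.
  specialize (Hbeta n); nra. }
apply Rle_trans with (cb * (Rpower 2 l0 * K1 * (Rpower 2 l0 * K2) *
    sum_f_R0 (fun k => Rpower (INR k + 1) alpha * x k ^ 2) M)).
2:{ replace (cb * (Rpower 2 l0 * K1) * (Rpower 2 l0 * K2) * ca) with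
      (cb * (Rpower 2 l0 * K1 * (Rpower 2 l0 * K2)) * ca) by ring.
    rewrite <- Rmult_assoc, (Rmult_assoc _ ca).
    apply Rmult_le_compat_l; [repeat apply Rmult_le_pos; lra|].
    rewrite scal_sum; apply sum_Rle; intros k _.
    pose proof (pow2_ge_0 (x k)); specialize (Halpha k); nra. }
apply Rmult_le_compat_l; [lra|].
apply schur_test with
  (u := fun k => Rpower (INR k + 1) (- ((1 + alpha) / 2)))
  (p := fun n => Rpower (INR n + 1) (- ((1 + beta) / 2))).
(* The row sums use [power_sum_bound] with [s = (1 + alpha) / 2], and the column sums use it
   with [s = (1 - beta) / 2]. *)
- intros n k; apply Rlt_le, hilbert_kernel_pos.
- intros k; apply Rpower_pos.
- intros n; apply Rlt_le, Rpower_pos.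
- nra.
- intros n.
  replace (- ((1 + beta) / 2)) with (1 - (1 + alpha) / 2 - l0) by (unfold l0; field).
  rewrite Rmult_assoc.
  eapply Rle_trans; [|apply Rmult_le_compat_l; [lra|];
    apply (power_sum_bound ((1 + alpha) / 2) l0 n M); unfold l0; lra].
  rewrite scal_sum; apply sum_Rle; intros k _.
  pose proof (Rpower_pos (INR k + 1) (- ((1 + alpha) / 2))).
  pose proof (hilbert_kernel_le lambda l0 n k ltac:(unfold l0 in *; lra)).
  nra.
- intros k.
  replace (Rpower (INR k + 1) (- ((1 + alpha) / 2)) * Rpower (INR k + 1) alpha)
    with (Rpower (INR k + 1) (1 - (1 - beta) / 2 - l0))
    by (rewrite <- Rpower_plus; f_equal; unfold l0; field).
  rewrite Rmult_assoc.
  eapply Rle_trans; [|apply Rmult_le_compat_l; [lra|];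
    apply (power_sum_bound ((1 - beta) / 2) l0 k N); unfold l0; lra].
  rewrite scal_sum; apply sum_Rle; intros n _.
  replace (Rpower (INR n + 1) beta * Rpower (INR n + 1) (- ((1 + beta) / 2)))
    with (Rpower (INR n + 1) (- ((1 - beta) / 2)))
    by (rewrite <- Rpower_plus; f_equal; field).
  pose proof (Rpower_pos (INR n + 1) (- ((1 - beta) / 2))).
  pose proof (hilbert_kernel_le lambda l0 n k ltac:(unfold l0 in *; lra)).
  rewrite (Rplus_comm (INR k)). nra.
- exact Hx.
Qed.

(** * Series of complex numbers and entire functions *)

(** The complex numbers; the name [C] alone denotes the binomial coefficients here. *)
Local Notation CC := Complex.C.

Lemma ex_series_bounded (a : nat -> R) (B : R) :
  (forall n, 0 <= a n) -> (forall N, sum_f_R0 a N <= B) ->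
  ex_series a /\ Series a <= B.
Proof.
intros Ha HB.
assert (Hex : ex_finite_lim_seq (sum_n a)).
{ apply ex_finite_lim_seq_incr with B; intros n.
  - rewrite !sum_n_Reals; simpl; specialize (Ha (S n)); lra.
  - rewrite sum_n_Reals; apply HB. }
split.
- destruct Hex as [l Hl]; exists l; exact Hl.
- apply Lim_seq_correct' in Hex.
  apply (is_lim_seq_le (sum_n a) (fun _ => B) (Series a) B); [|exact Hex|apply is_lim_seq_const].
  intros n; rewrite sum_n_Reals; apply HB.
Qed.

Lemma sum_f_R0_le_Series (a : nat -> R) (N : nat) :
  (forall n, 0 <= a n) -> ex_series a -> sum_f_R0 a N <= Series a.
Proof.
intros Ha Hex; apply sum_incr; [|exact Ha].
apply is_series_Reals, Series_correct, Hex.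
Qed.

Lemma Cseries_correct (a : nat -> CC) :
  ex_Cseries a -> @is_series C_AbsRing C_NormedModule a (Cseries a).
Proof. intros [s Hs]; rewrite (Cseries_unique a s Hs); exact Hs. Qed.

Lemma ex_Cseries_abs (a : nat -> CC) :
  ex_series (fun n => Cmod (a n)) -> ex_Cseries a.
Proof.
intros H; apply (@ex_series_le C_AbsRing C_CompleteNormedModule a (fun n => Cmod (a n))).
- intros n; apply Rle_refl.
- exact H.
Qed.

Lemma Cmod_sum_n (a : nat -> CC) (N : nat) :
  Cmod (@sum_n C_AbelianGroup a N) <= sum_f_R0 (fun n => Cmod (a n)) N.
Proof.
rewrite <- sum_n_Reals.
exact (@norm_sum_n_m C_AbsRing C_NormedModule a 0 N).
Qed.

Lemma is_Cseries_Cmod_le (a : nat -> CC) (s : CC) (B : R) :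
  @is_series C_AbsRing C_NormedModule a s ->
  (forall N, sum_f_R0 (fun n => Cmod (a n)) N <= B) -> Cmod s <= B.
Proof.
intros Hs HB.
assert (Hlim : is_lim_seq (fun N => Cmod (@sum_n C_AbelianGroup a N)) (Cmod s)).
{ eapply filterlim_comp; [exact Hs|].
  exact (@filterlim_norm C_AbsRing C_NormedModule s). }
apply (is_lim_seq_le _ (fun _ => B) (Cmod s) B) in Hlim;
  [exact Hlim| |apply is_lim_seq_const].
intros N; eapply Rle_trans; [apply Cmod_sum_n|apply HB].
Qed.

Lemma nat_pow_pred_le (r : R) (n : nat) :
  0 <= r -> INR n * r ^ pred n <= (r + 1) ^ n.
Proof.
intros Hr.
destruct n as [|n]; [simpl; lra|].
change (pred (S n)) with n.
induction n as [|n IH]; [simpl; lra|].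
rewrite S_INR; simpl pow in *.
assert (H1 : r ^ n <= (r + 1) ^ n) by (apply pow_incr; lra).
assert (H2 : 0 <= r ^ n) by (apply pow_le; lra).
assert (H3 : 0 <= (r + 1) ^ n) by (apply pow_le; lra).
nra.
Qed.

(** Second-order remainder of [z^n]. Write [E n] for it and [d n] for the derivative of
    [z^n]; then [E (n+1) = (z+h) E n + h^2 d n], because [d (n+1) = z d n + z^n]. *)
Lemma Cpow_remainder_le (z h : CC) (n : nat) :
  Cmod h <= 1 ->
  Cmod ((z + h) ^ n - z ^ n - h * (RtoC (INR n) * z ^ pred n))%C <=
  Cmod h ^ 2 * (Cmod z + 2) ^ n.
Proof.
intros Hh.
pose proof (Cmod_ge_0 z) as Hz; pose proof (Cmod_ge_0 h) as Hh0.
induction n as [|n IH].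
- replace ((z + h) ^ 0 - z ^ 0 - h * (RtoC (INR 0) * z ^ pred 0))%C with (RtoC 0)
    by (simpl; ring).
  rewrite Cmod_0; simpl; nra.
- assert (Hd : (RtoC (INR (S n)) * z ^ pred (S n) =
                z * (RtoC (INR n) * z ^ pred n) + z ^ n)%C).
  { destruct n as [|n]; [simpl; ring|].
    rewrite (S_INR (S n)), RtoC_plus; simpl pred; rewrite !Cpow_S; ring. }
  rewrite Hd.
  set (d := (RtoC (INR n) * z ^ pred n)%C) in *.
  assert (Hdn : Cmod d <= (Cmod z + 1) ^ n).
  { unfold d; rewrite Cmod_mult, Cmod_R, Cmod_pow, Rabs_pos_eq by apply pos_INR.
    apply nat_pow_pred_le; exact Hz. }
  rewrite !Cpow_S.
  replace ((z + h) * (z + h) ^ n - z * z ^ n - h * (z * d + z ^ n))%C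
    with ((z + h) * ((z + h) ^ n - z ^ n - h * d) + h * (h * d))%C by ring.
  set (E := ((z + h) ^ n - z ^ n - h * d)%C) in *.
  eapply Rle_trans; [apply Cmod_triangle|].
  rewrite !Cmod_mult.
  assert (H1 : Cmod (z + h)%C <= Cmod z + 1).
  { eapply Rle_trans; [apply Cmod_triangle|lra]. }
  assert (H2 : (Cmod z + 1) ^ n <= (Cmod z + 2) ^ n) by (apply pow_incr; lra).
  pose proof (Cmod_ge_0 (z + h)%C) as P1; pose proof (Cmod_ge_0 E) as P2; pose proof (Cmod_ge_0 d) as P3.
  assert (H3 : Cmod (z + h)%C * Cmod E <= (Cmod z + 1) * (Cmod h ^ 2 * (Cmod z + 2) ^ n))
    by (apply Rmult_le_compat; assumption).
  assert (H4 : Cmod h * (Cmod h * Cmod d) <= Cmod h ^ 2 * (Cmod z + 2) ^ n).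
  { replace (Cmod h * (Cmod h * Cmod d)) with (Cmod h ^ 2 * Cmod d) by ring.
    apply Rmult_le_compat_l; [apply pow2_ge_0|lra]. }
  change ((Cmod z + 2) ^ S n) with ((Cmod z + 2) * (Cmod z + 2) ^ n).
  nra.
Qed.

Lemma pow_n_Cpow (z : CC) (n : nat) : @pow_n C_Ring z n = (z ^ n)%C.
Proof.
induction n as [|n IH]; [reflexivity|].
simpl; rewrite IH; reflexivity.
Qed.

Lemma has_expansion_series (f : CC -> CC) (c : nat -> CC) :
  has_expansion f c <->
  (forall z, @is_series C_AbsRing C_NormedModule (fun n => (c n * z ^ n)%C) (f z)).
Proof.
assert (Heq : forall z n, @scal C_AbsRing C_NormedModule (@pow_n C_Ring z n) (c n) = (c n * z ^ n)%C).
{ intros z n; rewrite pow_n_Cpow; apply Cmult_comm. }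
split; intros H z; (eapply is_series_ext; [|exact (H z)]); intros n; cbv beta.
- apply Heq.
- symmetry; apply Heq.
Qed.

(** The derivative is the sum of the differentiated series; by [Cpow_remainder_le] the
    remainder is at most [|h|^2] times the sum of [|c_n| (|z|+2)^n]. *)
Lemma entire_of_abs_summable (f : CC -> CC) (c : nat -> CC) :
  has_expansion f c ->
  (forall r, 0 <= r -> ex_series (fun n => Cmod (c n) * r ^ n)) ->
  entire f.
Proof.
intros Hf Hc z.
pose proof (proj1 (has_expansion_series f c) Hf) as Hs; clear Hf.
pose proof (Cmod_ge_0 z) as Hz.
assert (Hr : 0 <= Cmod z + 2) by lra.
pose proof (Hc (Cmod z + 2) Hr) as HA.
set (A := Series (fun n => Cmod (c n) * (Cmod z + 2) ^ n)).
assert (HAterm : forall n, 0 <= Cmod (c n) * (Cmod z + 2) ^ n).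
{ intros n; apply Rmult_le_pos; [apply Cmod_ge_0|apply pow_le; lra]. }
assert (HApart : forall N, sum_f_R0 (fun n => Cmod (c n) * (Cmod z + 2) ^ n) N <= A).
{ intros N; apply sum_f_R0_le_Series; assumption. }
assert (HA0 : 0 <= A).
{ eapply Rle_trans; [|apply (HApart O)]; apply HAterm. }
set (d := fun n => (c n * (RtoC (INR n) * z ^ pred n))%C).
assert (Hd : ex_Cseries d).
{ apply ex_Cseries_abs.
  apply (@ex_series_le R_AbsRing R_CompleteNormedModule _
           (fun n => Cmod (c n) * (Cmod z + 2) ^ n)); [|exact HA].
  intros n; unfold norm; simpl; unfold abs; simpl.
  rewrite Rabs_pos_eq by apply Cmod_ge_0.
  unfold d; rewrite !Cmod_mult, Cmod_R, Cmod_pow, Rabs_pos_eq by apply pos_INR.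
  apply Rmult_le_compat_l; [apply Cmod_ge_0|].
  eapply Rle_trans; [apply nat_pow_pred_le; exact Hz|].
  apply pow_incr; lra. }
apply Cseries_correct in Hd.
set (L := Cseries d) in *.
exists L; split; [apply (@is_linear_scal_l C_AbsRing C_NormedModule L)|].
intros x Hx.
apply (@is_filter_lim_locally_unique C_AbsRing (AbsRing_NormedModule C_AbsRing)) in Hx.
subst x.
intros eps.
assert (Hdelta : 0 < Rmin 1 (eps / (A + 1))).
{ apply Rmin_pos; [lra|]; apply Rdiv_lt_0_compat; [apply cond_pos|lra]. }
eapply filter_imp;
  [|exact (@locally_ball_norm C_AbsRing (AbsRing_NormedModule C_AbsRing) z (mkposreal _ Hdelta))].
intros y Hy.
change (Cmod (y - z)%C < Rmin 1 (eps / (A + 1))) in Hy.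
change (Cmod (f y - f z - (y - z) * L)%C <= eps * Cmod (y - z)%C).
set (h := (y - z)%C) in *.
assert (Hsub : forall u v : CC, u = (v + (u - v))%C) by (intros; ring).
pose proof (Hsub y z : y = (z + h)%C) as Hyz.
assert (Hh1 : Cmod h <= 1).
{ eapply Rle_trans; [apply Rlt_le, Hy|apply Rmin_l]. }
assert (Hh2 : Cmod h * (A + 1) <= eps).
{ apply Rle_div_r; [lra|]; eapply Rle_trans; [apply Rlt_le, Hy|apply Rmin_r]. }
assert (Hmain : Cmod (f y - f z - h * L)%C <= Cmod h ^ 2 * A).
{ apply (is_Cseries_Cmod_le
    (fun n => (c n * ((z + h) ^ n - z ^ n - h * (RtoC (INR n) * z ^ pred n)))%C)).
  - pose proof (is_series_minus _ _ _ _
      (is_series_minus _ _ _ _ (Hs y) (Hs z)) (is_series_scal_l h _ _ Hd)) as H.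
    eapply is_series_ext; [|exact H].
    intros n; cbv beta; unfold d; rewrite <- Hyz.
    set (p := (y ^ n)%C); set (q := (z ^ n)%C).
    change (@eq CC (c n * p - c n * q - h * (c n * (RtoC (INR n) * z ^ pred n)))%C
            (c n * (p - q - h * (RtoC (INR n) * z ^ pred n)))%C).
    ring.
  - intros N.
    apply Rle_trans with (Cmod h ^ 2 * sum_f_R0 (fun n => Cmod (c n) * (Cmod z + 2) ^ n) N).
    + rewrite scal_sum; apply sum_Rle; intros n _.
      rewrite Cmod_mult, Rmult_assoc, (Rmult_comm _ (Cmod h ^ 2)).
      apply Rmult_le_compat_l; [apply Cmod_ge_0|].
      apply Cpow_remainder_le; exact Hh1.
    + apply Rmult_le_compat_l; [apply pow2_ge_0|apply HApart]. }
eapply Rle_trans; [exact Hmain|].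
pose proof (Cmod_ge_0 h); nra.
Qed.

(** * Power series in Fock spaces *)

Lemma INR_succ_le_pow2 (n : nat) : INR n + 1 <= 2 ^ n.
Proof.
induction n as [|n IH]; [simpl; lra|].
rewrite S_INR; simpl pow; pose proof (pow_R1_Rle 2 n ltac:(lra)); lra.
Qed.

(** Bounded Fock terms already give convergence everywhere: [|c_n| r^n] is at most
    [B / 2^n + C (4 r^2)^n / n!], by the arithmetic-geometric mean inequality; the factor
    [2^n] absorbs [(n+1)^(-beta)], which is at most [n + 1]. *)
Lemma fock_coef_summable (theta beta B : R) (c : nat -> CC) :
  0 < theta -> -1 < beta ->
  (forall n, Rpower (INR n + theta) beta * Cmod (c n) ^ 2 * INR (fact n) <= B) ->
  forall r, 0 <= r -> ex_series (fun n => Cmod (c n) * r ^ n).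
Proof.
intros Ht Hb HB r Hr.
destruct (shift_power_equiv theta beta Ht) as [C [HC Hequiv]].
apply (@ex_series_le R_AbsRing R_CompleteNormedModule _
   (fun n => B * (/ 2) ^ n + C * ((4 * r ^ 2) ^ n * / INR (fact n)))).
2:{ apply (@ex_series_plus R_AbsRing R_NormedModule).
    - apply (@ex_series_scal_l R_AbsRing R_NormedModule), ex_series_geom.
      rewrite Rabs_pos_eq; lra.
    - apply (@ex_series_scal_l R_AbsRing R_NormedModule).
      exists (exp (4 * r ^ 2)).
      eapply is_series_ext; [|exact (is_exp_Reals (4 * r ^ 2))].
      intros n; cbv beta; rewrite pow_n_pow; reflexivity. }
intros n; unfold norm; simpl; unfold abs; simpl.
fold (r ^ n). specialize (HB n); destruct (Hequiv n) as [_ Hn]; clear Hequiv.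
pose proof (Cmod_ge_0 (c n)) as Hy.
assert (Hrn : 0 <= r ^ n) by (apply pow_le; exact Hr).
rewrite Rabs_pos_eq by (apply Rmult_le_pos; assumption).
pose proof (Rpower_pos (INR n + theta) beta) as Hw.
pose proof (INR_fact_lt_0 n) as Hf.
pose proof (pow_lt 2 n ltac:(lra)) as H2.
set (y := Cmod (c n)) in *; set (w := Rpower (INR n + theta) beta) in *.
set (t := INR (fact n)) in *.
assert (Hinv : 1 <= C * 2 ^ n * w).
{ pose proof (pos_INR n) as Hn0.
  assert (H1 : Rpower (INR n + 1) (- beta) <= 2 ^ n).
  { apply Rle_trans with (Rpower (INR n + 1) 1).
    - apply Rle_Rpower; lra.
    - rewrite Rpower_1 by lra; apply INR_succ_le_pow2. }
  assert (H3 : Rpower (INR n + 1) (- beta) * Rpower (INR n + 1) beta = 1).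
  { rewrite <- Rpower_plus, Rplus_opp_l; apply Rpower_O; lra. }
  rewrite <- H3.
  apply Rle_trans with (2 ^ n * (C * w)); [|apply Req_le; ring].
  apply Rmult_le_compat; try apply Rlt_le, Rpower_pos; assumption. }
assert (Hs : 0 < w * t / 2 ^ n).
{ apply Rdiv_lt_0_compat; [apply Rmult_lt_0_compat|]; assumption. }
(* [y q <= y^2 s + q^2 / s] with [s = w t / 2^n], which turns the first term into
   the bounded Fock term divided by [2^n]. *)
apply Rle_trans with (y ^ 2 * (w * t / 2 ^ n) + (r ^ n) ^ 2 / (w * t / 2 ^ n)).
- set (s := w * t / 2 ^ n) in *; set (q := r ^ n) in *.
  apply Rmult_le_reg_r with s; [exact Hs|].
  replace ((y ^ 2 * s + q ^ 2 / s) * s) with ((y * s) ^ 2 + q ^ 2) by (field; lra).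
  pose proof (pow2_ge_0 (y * s - q)); pose proof (pow2_ge_0 (y * s)); pose proof (pow2_ge_0 q).
  nra.
- apply Rplus_le_compat.
  + rewrite pow_inv.
    replace (y ^ 2 * (w * t / 2 ^ n)) with (w * y ^ 2 * t * / 2 ^ n) by (field; lra).
    apply Rmult_le_compat_r; [apply Rlt_le, Rinv_0_lt_compat; exact H2|exact HB].
  + replace ((4 * (r * (r * 1))) ^ n) with (2 ^ n * 2 ^ n * (r ^ n) ^ 2).
    2:{ replace (4 * (r * (r * 1))) with (2 * 2 * r * r) by ring.
        rewrite !Rpow_mult_distr; ring. }
    set (q := r ^ n) in *.
    apply Rmult_le_reg_r with (w * t); [apply Rmult_lt_0_compat; assumption|].
    replace (q ^ 2 / (w * t / 2 ^ n) * (w * t)) with (q ^ 2 * 2 ^ n * 1)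
      by (field; lra).
    replace (C * (2 ^ n * 2 ^ n * q ^ 2 * / t) * (w * t)) with
      (q ^ 2 * 2 ^ n * (C * 2 ^ n * w)) by (field; lra).
    apply Rmult_le_compat_l; [|exact Hinv].
    apply Rmult_le_pos; [apply pow2_ge_0|lra].
Qed.

Lemma fock_term_ge_0 (theta alpha : R) (f : CC -> CC) (n : nat) :
  0 <= fock_term theta alpha f n.
Proof.
unfold fock_term; apply Rmult_le_pos; [|apply pos_INR].
apply Rmult_le_pos; [apply Rlt_le, Rpower_pos|apply pow2_ge_0].
Qed.

(** A sequence of coefficients with bounded Fock partial sums defines a function of the Fock
    space, of which it is the Taylor sequence. *)
Lemma power_series_in_fock (theta beta B : R) (c : nat -> CC) :
  0 < theta -> -1 < beta ->
  (forall N, sum_f_R0 (fun n =>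
     Rpower (INR n + theta) beta * Cmod (c n) ^ 2 * INR (fact n)) N <= B) ->
  let f := fun z : CC => Cseries (fun n => (c n * z ^ n)%C) in
  (forall z : CC, ex_Cseries (fun n => (c n * z ^ n)%C)) /\
  taylor f = c /\ in_fock theta beta f /\ Series (fock_term theta beta f) <= B.
Proof.
intros Ht Hb HB f.
set (g := fun n => _) in HB.
assert (Hg : forall n, 0 <= g n).
{ intros n; unfold g; apply Rmult_le_pos; [|apply pos_INR].
  apply Rmult_le_pos; [apply Rlt_le, Rpower_pos|apply pow2_ge_0]. }
assert (Hsum : forall r, 0 <= r -> ex_series (fun n => Cmod (c n) * r ^ n)).
{ apply (fock_coef_summable theta beta B); [assumption|assumption|].
  intros n; eapply Rle_trans; [|apply (HB n)].
  exact (sum_f_R0_term_le g n Hg). }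
assert (Hex : forall z : CC, ex_Cseries (fun n => (c n * z ^ n)%C)).
{ intros z; apply ex_Cseries_abs.
  eapply ex_series_ext; [|exact (Hsum (Cmod z) (Cmod_ge_0 z))].
  intros n; cbv beta; rewrite Cmod_mult, Cmod_pow; reflexivity. }
assert (Hexp : has_expansion f c).
{ apply has_expansion_series; intros z; apply Cseries_correct, Hex. }
pose proof (taylor_unique f c Hexp) as Htay.
destruct (ex_series_bounded g B Hg HB) as [Hg1 Hg2].
assert (Hterm : forall n, g n = fock_term theta beta f n).
{ intros n; unfold fock_term; rewrite Htay; reflexivity. }
repeat split.
- exact Hex.
- exact Htay.
- exact (entire_of_abs_summable f c Hexp Hsum).
- rewrite Htay; exact Hexp.
- eapply ex_series_ext; [exact Hterm|exact Hg1].
- rewrite <- (Series_ext _ _ Hterm); exact Hg2.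
Qed.

(** * Sufficiency of the condition on the exponent *)

Lemma RtoC_neq_0 (x : R) : x <> 0 -> RtoC x <> RtoC 0.
Proof. intros H E; apply H; exact (f_equal fst E). Qed.

Lemma Cmod_hilbert_term (lambda : R) (f : CC -> CC) (n k : nat) :
  Cmod (hilbert_term lambda f n k) =
  hilbert_kernel lambda n k * (Cmod (taylor f k) * sqrt (INR (fact k))).
Proof.
unfold hilbert_term, hilbert_kernel.
pose proof (nat_rpow_ge_0 (k + n) lambda) as Hm.
rewrite Cmod_div by (apply RtoC_neq_0; lra).
rewrite Cmod_mult, !Cmod_R, (Rabs_pos_eq (sqrt _)) by apply sqrt_pos.
rewrite Rabs_pos_eq by lra.
unfold Rdiv; ring.
Qed.

Lemma hilbert_coef_square (lambda : R) (f : CC -> CC) (n : nat) :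
  Cmod (hilbert_coef lambda f n) ^ 2 * INR (fact n) =
  Cmod (Cseries (hilbert_term lambda f n)) ^ 2.
Proof.
unfold hilbert_coef.
pose proof (INR_fact_lt_0 n) as Hf; pose proof (sqrt_lt_R0 _ Hf) as Hs.
rewrite Cmod_mult, Cmod_R, Rabs_pos_eq by (apply Rlt_le, Rinv_0_lt_compat, Hs).
rewrite <- (sqrt_sqrt (INR (fact n))) at 2 by lra.
field; lra.
Qed.

Lemma weighted_square_sum_limit (w : nat -> R) (S : nat -> nat -> R) (T : nat -> R)
    (B : R) (N : nat) :
  (forall n, is_lim_seq (S n) (T n)) ->
  (forall M, sum_f_R0 (fun n => w n * S n M ^ 2) N <= B) ->
  sum_f_R0 (fun n => w n * T n ^ 2) N <= B.
Proof.
intros HS HB.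
assert (Hterm : forall n, is_lim_seq (fun M => w n * S n M ^ 2) (w n * T n ^ 2)).
{ intros n.
  apply (is_lim_seq_scal_l (fun M => S n M ^ 2) (w n) (T n ^ 2)).
  simpl pow; apply is_lim_seq_mult'; [apply HS|].
  apply is_lim_seq_mult'; [apply HS|apply is_lim_seq_const]. }
assert (Hlim : is_lim_seq (fun M => sum_f_R0 (fun n => w n * S n M ^ 2) N)
                 (sum_f_R0 (fun n => w n * T n ^ 2) N)).
{ clear HB; induction N as [|N IH]; cbn [sum_f_R0]; [apply Hterm|].
  apply is_lim_seq_plus'; [exact IH|apply Hterm]. }
apply (is_lim_seq_le _ (fun _ => B) _ B HB Hlim (is_lim_seq_const B)).
Qed.

Lemma hilbert_op_bounded_of_exponent (lambda theta alpha beta : R) :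
  -1 < alpha < 1 -> -1 < beta < 1 -> 0 < theta ->
  1 + 1 / 2 * (beta - alpha) <= lambda ->
  hilbert_op_bounded lambda theta alpha beta.
Proof.
intros Ha Hb Ht Hl.
destruct (hilbert_kernel_sections lambda alpha beta theta Ha Hb Ht Hl) as [K [HK Hsec]].
exists (sqrt K); split; [apply sqrt_lt_R0; exact HK|].
intros f [Hent [Hexp Hser]].
set (x := fun k => Cmod (taylor f k) * sqrt (INR (fact k))).
set (w := fun n => Rpower (INR n + theta) beta).
assert (Hx : forall k, 0 <= x k).
{ intros k; apply Rmult_le_pos; [apply Cmod_ge_0|apply sqrt_pos]. }
set (A := Series (fock_term theta alpha f)).
assert (HA : 0 <= A).
{ eapply Rle_trans; [|apply (sum_f_R0_le_Series _ 0); [apply fock_term_ge_0|exact Hser]].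
  apply fock_term_ge_0. }
set (S := fun n M => sum_f_R0 (fun k => hilbert_kernel lambda n k * x k) M).
assert (HS0 : forall n k, 0 <= hilbert_kernel lambda n k * x k).
{ intros n k; apply Rmult_le_pos; [apply Rlt_le, hilbert_kernel_pos|apply Hx]. }
assert (Hbound : forall N M, sum_f_R0 (fun n => w n * S n M ^ 2) N <= K * A).
{ intros N M; eapply Rle_trans; [apply (Hsec x N M Hx)|].
  apply Rmult_le_compat_l; [lra|].
  eapply Rle_trans; [|apply (sum_f_R0_le_Series _ M); [apply fock_term_ge_0|exact Hser]].
  apply Req_le, sum_eq; intros k _; unfold fock_term, x.
  rewrite Rpow_mult_distr, pow2_sqrt by apply pos_INR; ring. }
assert (Hw : forall n, 0 < w n) by (intros n; apply Rpower_pos).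
(* Each row of partial sums is bounded, so it converges; [t <= t^2 + 1] avoids a square
   root. *)
assert (HSn : forall n M, S n M <= K * A / w n + 1).
{ intros n M.
  assert (H1 : w n * S n M ^ 2 <= K * A).
  { eapply Rle_trans; [|apply (Hbound n M)].
    set (g := fun i => w i * S i M ^ 2).
    assert (Hg : forall i, 0 <= g i).
    { intros i; apply Rmult_le_pos; [apply Rlt_le, Hw|apply pow2_ge_0]. }
    exact (sum_f_R0_term_le g n Hg). }
  assert (H2 : S n M ^ 2 <= K * A / w n).
  { apply (proj1 (Rle_div_r _ _ _ (Hw n))); lra. }
  pose proof (pow2_ge_0 (S n M - 1)); nra. }
assert (Hconv : forall n, ex_series (fun k => hilbert_kernel lambda n k * x k)).
{ intros n; apply (ex_series_bounded _ (K * A / w n + 1)); [apply HS0|apply HSn]. }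
set (T := fun n => Series (fun k => hilbert_kernel lambda n k * x k)).
assert (HST : forall n, is_lim_seq (S n) (T n)).
{ intros n.
  apply is_lim_seq_ext with (sum_n (fun k => hilbert_kernel lambda n k * x k)).
  - intros M; apply sum_n_Reals.
  - apply Series_correct, Hconv. }
assert (HexT : forall n, ex_Cseries (hilbert_term lambda f n)).
{ intros n; apply ex_Cseries_abs.
  eapply ex_series_ext; [|exact (Hconv n)].
  intros k; cbv beta; rewrite Cmod_hilbert_term; reflexivity. }
assert (HTn : forall n, Cmod (Cseries (hilbert_term lambda f n)) <= T n).
{ intros n; apply (is_Cseries_Cmod_le (hilbert_term lambda f n)).
  - apply Cseries_correct, HexT.
  - intros N; eapply Rle_trans; [|apply (sum_f_R0_le_Series _ N (HS0 n) (Hconv n))].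
    apply Req_le, sum_eq; intros k _; apply Cmod_hilbert_term. }
destruct (power_series_in_fock theta beta (K * A) (hilbert_coef lambda f) Ht ltac:(lra))
  as [Hz [_ [Hin Hnorm]]].
{ intros N.
  eapply Rle_trans; [|apply (weighted_square_sum_limit w S T (K * A) N HST)].
  - apply sum_Rle; intros n _.
    rewrite Rmult_assoc, hilbert_coef_square.
    apply Rmult_le_compat_l; [apply Rlt_le, Hw|].
    apply pow_incr; split; [apply Cmod_ge_0|apply HTn].
  - intros M; apply Hbound. }
split; [split; [exact HexT|exact Hz]|split; [exact Hin|]].
unfold fock_norm; fold A.
rewrite <- sqrt_mult by lra.
apply sqrt_le_1_alt; exact Hnorm.
Qed.

(** * Necessity of the condition on the exponent *)

(** Indicator sequence of the integers [k] with [N <= k < 2N]. *)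
Definition block (N k : nat) : R :=
  if andb (Nat.leb N k) (Nat.ltb k (2 * N)) then 1 else 0.

Lemma block_cases (N k : nat) :
  (block N k = 1 /\ (N <= k < 2 * N)%nat) \/ block N k = 0.
Proof.
unfold block; destruct (Nat.leb_spec N k); destruct (Nat.ltb_spec k (2 * N));
  simpl andb; cbv iota; auto.
Qed.

(** Number of elements of the block up to [M], in a form suited to induction on [M]. *)
Lemma block_sum (N M : nat) :
  sum_f_R0 (block N) M = INR (Nat.min (S M) (2 * N) - Nat.min (S M) N).
Proof.
assert (Hstep : forall k, block N k =
  INR (Nat.min (S k) (2 * N) - Nat.min (S k) N) - INR (Nat.min k (2 * N) - Nat.min k N)).
{ intros k; unfold block; destruct (Nat.leb_spec N k); destruct (Nat.ltb_spec k (2 * N));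
    simpl andb; cbv iota.
  - replace (Nat.min (S k) (2 * N) - Nat.min (S k) N)%nat
      with (S (Nat.min k (2 * N) - Nat.min k N)) by lia.
    rewrite S_INR; ring.
  - replace (Nat.min (S k) (2 * N) - Nat.min (S k) N)%nat
      with (Nat.min k (2 * N) - Nat.min k N)%nat by lia; ring.
  - replace (Nat.min (S k) (2 * N) - Nat.min (S k) N)%nat
      with (Nat.min k (2 * N) - Nat.min k N)%nat by lia; ring.
  - replace (Nat.min (S k) (2 * N) - Nat.min (S k) N)%nat
      with (Nat.min k (2 * N) - Nat.min k N)%nat by lia; ring. }
induction M as [|M IH]; cbn [sum_f_R0]; rewrite Hstep.
- rewrite !Nat.min_0_l; simpl (INR (0 - 0)); ring.
- rewrite IH; ring.
Qed.

Lemma Rpower_le_doubling (x y e : R) :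
  0 < x -> x <= y <= 2 * x -> -1 < e < 1 -> Rpower y e <= 2 * Rpower x e.
Proof.
intros Hx Hy He; pose proof (Rpower_pos x e) as Hp.
destruct (Rle_dec 0 e) as [H|H].
- apply Rle_trans with (Rpower (2 * x) e); [apply Rle_Rpower_l; lra|].
  rewrite <- Rpower_mult_distr by lra.
  assert (H2 : Rpower 2 e <= Rpower 2 1) by (apply Rle_Rpower; lra).
  rewrite Rpower_1 in H2 by lra; nra.
- pose proof (Rpower_antitone x y e ltac:(lra) ltac:(lra)); lra.
Qed.

Lemma Rpower_nat_unbounded (d K : R) :
  0 < d -> ~ (forall N, (1 <= N)%nat -> Rpower (INR N) d <= K).
Proof.
intros Hd H.
assert (HK : 0 < K).
{ eapply Rlt_le_trans; [apply (Rpower_pos (INR 1) d)|apply (H 1%nat (le_n _))]. }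
destruct (INR_archimed 1 (Rpower (K + 1) (/ d)) ltac:(lra)) as [N HN].
rewrite Rmult_1_r in HN.
pose proof (Rpower_pos (K + 1) (/ d)) as Hp.
assert (HN1 : (1 <= N)%nat).
{ destruct N; [simpl in HN; lra|lia]. }
specialize (H N HN1).
assert (H1 : Rpower (Rpower (K + 1) (/ d)) d <= Rpower (INR N) d)
  by (apply Rle_Rpower_l; lra).
rewrite Rpower_mult, Rinv_l, Rpower_1 in H1 by lra; lra.
Qed.

Lemma hilbert_kernel_block_lower (lambda : R) (N n k : nat) :
  0 < lambda -> (1 <= N)%nat -> (n < 2 * N)%nat -> (k < 2 * N)%nat ->
  / (2 * Rpower (4 * INR N) lambda) <= hilbert_kernel lambda n k.
Proof.
intros Hl HN Hn Hk; unfold hilbert_kernel.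
assert (H1 : 1 <= INR N) by (apply (le_INR 1); exact HN).
assert (H2 : 1 <= Rpower (4 * INR N) lambda).
{ rewrite <- (Rpower_O (4 * INR N)) by lra; apply Rle_Rpower; lra. }
apply Rinv_le_contravar.
- pose proof (nat_rpow_ge_0 (k + n) lambda); lra.
- assert (H3 : nat_rpow (k + n) lambda <= Rpower (4 * INR N) lambda).
  { assert (H4 : INR (k + n) <= 4 * INR N).
    { replace (4 * INR N) with (INR (4 * N)) by (rewrite mult_INR; simpl; ring).
      apply le_INR; lia. }
    destruct (k + n)%nat as [|m]; unfold nat_rpow; [lra|].
    apply Rle_Rpower_l; [lra|split; [|exact H4]].
    apply lt_0_INR; lia. }
  lra.
Qed.

Lemma exponent_of_hilbert_op_bounded (lambda theta alpha beta : R) :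
  0 < lambda -> -1 < alpha < 1 -> -1 < beta < 1 -> 0 < theta ->
  hilbert_op_bounded lambda theta alpha beta ->
  1 + 1 / 2 * (beta - alpha) <= lambda.
Proof.
intros Hl Ha Hb Ht [K [HK Hbd]].
apply Rnot_lt_le; intros Hlt.
destruct (shift_power_equiv theta alpha Ht) as [ca [Hca Halpha]].
destruct (shift_power_equiv theta beta Ht) as [cb [Hcb Hbeta]].
apply (Rpower_nat_unbounded (2 + beta - alpha - 2 * lambda)
   (K ^ 2 * (ca * 2) * (2 * cb) * (2 * Rpower 4 lambda) ^ 2)); [lra|].
intros N HN.
assert (HN1 : 1 <= INR N) by (apply (le_INR 1); exact HN).
set (a := fun k : nat => RtoC (block N k / sqrt (INR (fact k)))).
assert (Hblock0 : forall k, 0 <= block N k).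
{ intros k; destruct (block_cases N k) as [[-> _]| ->]; lra. }
assert (Hpos : forall k, 0 < sqrt (INR (fact k))).
{ intros k; apply sqrt_lt_R0, INR_fact_lt_0. }
destruct (power_series_in_fock theta alpha (INR N * (ca * 2 * Rpower (INR N) alpha)) a
   Ht ltac:(lra)) as [_ [Htay [Hin Hnorm]]].
{ intros M.
  apply Rle_trans with (sum_f_R0 (block N) M * (ca * 2 * Rpower (INR N) alpha)).
  - rewrite Rmult_comm, scal_sum; apply sum_Rle; intros k _.
    unfold a; rewrite Cmod_R, Rabs_pos_eq.
    2:{ apply Rle_div_r; [apply Hpos|rewrite Rmult_0_l; apply Hblock0]. }
    rewrite Rmult_assoc.
    replace ((block N k / sqrt (INR (fact k))) ^ 2 * INR (fact k)) with (block N k ^ 2).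
    2:{ rewrite <- (sqrt_sqrt (INR (fact k))) at 2 by apply pos_INR.
        field; apply Rgt_not_eq, Hpos. }
    destruct (block_cases N k) as [[-> Hk]| ->]; [|simpl; lra].
    rewrite pow1, Rmult_1_r, Rmult_1_l.
    eapply Rle_trans; [apply (Halpha k)|].
    rewrite Rmult_assoc; apply Rmult_le_compat_l; [lra|].
    apply Rpower_le_doubling; [lra| |exact Ha].
    rewrite <- S_INR; split; [apply le_INR; lia|].
    replace (2 * INR N) with (INR (2 * N)) by (rewrite mult_INR; simpl; ring).
    apply le_INR; lia.
  - pose proof (Rpower_pos (INR N) alpha) as Hp.
    apply Rmult_le_compat_r; [apply Rmult_le_pos; lra|].
    rewrite block_sum; apply le_INR; lia. }
set (f := fun z : CC => Cseries (fun n => (a n * z ^ n)%C)) in *.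
destruct (Hbd f Hin) as [[Hdef1 Hdef2] [Hin2 Hle]].
assert (Hexp : has_expansion (hilbert_op lambda f) (hilbert_coef lambda f)).
{ apply has_expansion_series; intros z; apply Cseries_correct, Hdef2. }
apply taylor_unique in Hexp.
set (c0 := / (2 * Rpower (4 * INR N) lambda)).
assert (Hc0 : 0 < c0).
{ apply Rinv_0_lt_compat; pose proof (Rpower_pos (4 * INR N) lambda); lra. }
assert (Hblock_sum : sum_f_R0 (block N) (2 * N) = INR N).
{ rewrite block_sum; f_equal; lia. }
(* The [N] terms with [N <= k < 2N] are each at least [c0], and the others are
   nonnegative. *)
assert (Hcoef : forall n, (n < 2 * N)%nat ->
   INR N * c0 <= Cmod (Cseries (hilbert_term lambda f n))).
{ intros n Hn.
  assert (Hre : forall k, Re (hilbert_term lambda f n k) = hilbert_kernel lambda n k * block N k).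
  { intros k; unfold hilbert_term; rewrite Htay; unfold a.
    pose proof (nat_rpow_ge_0 (k + n) lambda) as Hm.
    rewrite <- RtoC_mult, <- RtoC_div by lra.
    change (block N k / sqrt (INR (fact k)) * sqrt (INR (fact k)) /
              (nat_rpow (k + n) lambda + 1) = hilbert_kernel lambda n k * block N k).
    unfold hilbert_kernel; field; split; [lra|apply Rgt_not_eq, Hpos]. }
  pose proof (is_series_Re _ _ (Cseries_correct _ (Hdef1 n))) as Hs.
  eapply is_series_ext in Hs; [|exact Hre].
  assert (Hterm : forall k, 0 <= hilbert_kernel lambda n k * block N k).
  { intros k; apply Rmult_le_pos; [apply Rlt_le, hilbert_kernel_pos|apply Hblock0]. }
  eapply Rle_trans; [|apply Rle_trans with (1 := Rle_abs _); apply re_le_Cmod].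
  rewrite <- (is_series_unique _ _ Hs).
  eapply Rle_trans; [|apply (sum_f_R0_le_Series _ (2 * N)); [exact Hterm|eexists; exact Hs]].
  rewrite <- Hblock_sum, Rmult_comm, scal_sum; apply sum_Rle; intros k _.
  rewrite Rmult_comm.
  destruct (block_cases N k) as [[-> Hk]| ->]; [|lra].
  pose proof (hilbert_kernel_block_lower lambda N n k Hl HN Hn ltac:(lia)) as H.
  fold c0 in H; lra. }
assert (Hlow : INR N * (/ (2 * cb) * Rpower (INR N) beta * (INR N * c0) ^ 2) <=
   Series (fock_term theta beta (hilbert_op lambda f))).
{ eapply Rle_trans; [|apply (sum_f_R0_le_Series _ (2 * N)); [apply fock_term_ge_0|apply Hin2]].
  rewrite <- Hblock_sum at 1; rewrite Rmult_comm, scal_sum; apply sum_Rle; intros n _.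
  destruct (block_cases N n) as [[-> Hn]| ->];
    [|rewrite Rmult_0_l; apply fock_term_ge_0].
  unfold fock_term; rewrite Hexp, (Rmult_assoc (Rpower (INR n + theta) beta)), hilbert_coef_square, Rmult_1_l.
  apply Rmult_le_compat.
  - apply Rlt_le, Rmult_lt_0_compat; [apply Rinv_0_lt_compat; lra|apply Rpower_pos].
  - apply pow2_ge_0.
  - (* [n + 1] is between [N] and [2N]; doubling with exponent [- beta] bounds
       [(n+1)^beta] from below. *)
    assert (H1 : Rpower (INR n + 1) (- beta) <= 2 * Rpower (INR N) (- beta)).
    { apply Rpower_le_doubling; [lra| |lra].
      rewrite <- S_INR; split; [apply le_INR; lia|].
      replace (2 * INR N) with (INR (2 * N)) by (rewrite mult_INR; simpl; ring).
      apply le_INR; lia. }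
    rewrite !Rpower_Ropp in H1.
    pose proof (Rpower_pos (INR n + 1) beta) as P1; pose proof (Rpower_pos (INR N) beta) as P2.
    destruct (Hbeta n) as [_ H2].
    assert (H3 : Rpower (INR N) beta <= 2 * Rpower (INR n + 1) beta).
    { apply (Rmult_le_compat_r (Rpower (INR n + 1) beta * Rpower (INR N) beta)) in H1; [|nra].
      replace (/ Rpower (INR n + 1) beta * (Rpower (INR n + 1) beta * Rpower (INR N) beta))
        with (Rpower (INR N) beta) in H1 by (field; lra).
      replace (2 * / Rpower (INR N) beta * (Rpower (INR n + 1) beta * Rpower (INR N) beta))
        with (2 * Rpower (INR n + 1) beta) in H1 by (field; lra).
      exact H1. }
    apply Rmult_le_reg_l with (2 * cb); [lra|].
    replace (2 * cb * (/ (2 * cb) * Rpower (INR N) beta)) with (Rpower (INR N) beta)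
      by (field; lra).
    lra.
  - apply pow_incr; split; [|apply Hcoef; lia].
    apply Rmult_le_pos; lra. }
set (SF := Series (fock_term theta alpha f)) in *.
set (SH := Series (fock_term theta beta (hilbert_op lambda f))) in *.
assert (HSF0 : 0 <= SF).
{ eapply Rle_trans; [|apply (sum_f_R0_le_Series _ 0); [apply fock_term_ge_0|apply Hin]].
  apply fock_term_ge_0. }
assert (HSH0 : 0 <= SH).
{ eapply Rle_trans; [|apply (sum_f_R0_le_Series _ 0); [apply fock_term_ge_0|apply Hin2]].
  apply fock_term_ge_0. }
assert (HSH : SH <= K ^ 2 * SF).
{ unfold fock_norm in Hle; fold SF SH in Hle.
  rewrite <- (sqrt_sqrt SH HSH0), <- (sqrt_sqrt SF HSF0).
  replace (K ^ 2 * (sqrt SF * sqrt SF)) with ((K * sqrt SF) * (K * sqrt SF)) by ring.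
  apply Rmult_le_compat; auto using sqrt_pos. }
assert (Hall : INR N * (/ (2 * cb) * Rpower (INR N) beta * (INR N * c0) ^ 2) <=
   K ^ 2 * (INR N * (ca * 2 * Rpower (INR N) alpha))).
{ eapply Rle_trans; [exact Hlow|eapply Rle_trans; [exact HSH|]].
  apply Rmult_le_compat_l; [apply pow2_ge_0|exact Hnorm]. }
(* It remains to isolate the powers of [N]. *)
unfold c0 in Hall.
rewrite <- Rpower_mult_distr in Hall by lra.
replace (Rpower (INR N) (2 + beta - alpha - 2 * lambda)) with
  (INR N ^ 2 * Rpower (INR N) beta / (Rpower (INR N) alpha * Rpower (INR N) lambda ^ 2)).
2:{ rewrite <- (Rpower_pow 2 (INR N)) by lra.
    rewrite <- (Rpower_pow 2 (Rpower (INR N) lambda)) by apply Rpower_pos.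
    rewrite Rpower_mult.
    rewrite <- !Rpower_plus; unfold Rdiv; rewrite <- Rpower_Ropp, <- Rpower_plus.
    f_equal; simpl INR; ring. }
pose proof (Rpower_pos (INR N) alpha) as Pa; pose proof (Rpower_pos (INR N) beta) as Pb.
pose proof (Rpower_pos (INR N) lambda) as Pl; pose proof (Rpower_pos 4 lambda) as P4.
set (x := INR N) in *; set (pa := Rpower x alpha) in *; set (pb := Rpower x beta) in *.
set (pl := Rpower x lambda) in *; set (p4 := Rpower 4 lambda) in *.
apply Rle_div_l; [apply Rmult_lt_0_compat; [exact Pa|apply pow_lt; exact Pl]|].
assert (Hfac : 0 <= 2 * cb * (2 * p4) ^ 2 * pl ^ 2 / x).
{ apply Rlt_le, Rdiv_lt_0_compat; [|lra].
  repeat apply Rmult_lt_0_compat; try apply pow_lt; lra. }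
apply (Rmult_le_compat_r _ _ _ Hfac) in Hall.
replace (x * (/ (2 * cb) * pb * (x * / (2 * (p4 * pl))) ^ 2) *
         (2 * cb * (2 * p4) ^ 2 * pl ^ 2 / x)) with (x ^ 2 * pb) in Hall by (field; lra).
eapply Rle_trans; [exact Hall|].
apply Req_le; field; lra.
Qed.

Theorem theorem1p5 (lambda alpha beta : R)
    (hlambda : 0 < lambda)
    (halpha : -1 < alpha < 1) (hbeta : -1 < beta < 1)
    (theta : R) (htheta : 0 < theta) :
  hilbert_op_bounded lambda theta alpha beta <->
  lambda >= 1 + 1 / 2 * (beta - alpha).
Proof.
split; intros H.
- apply Rle_ge; apply (exponent_of_hilbert_op_bounded lambda theta alpha beta); assumption.
- apply hilbert_op_bounded_of_exponent; try assumption; apply Rge_le; exact H.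
Qed.
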